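(* Let $\theta$ be a real number, let $G_1$ and $G_2$ be two vertex-disjoint $\theta$-super positive graphs, and let $S_i\in\mathfrak P(\theta,G_i)$ for $i=1,2$. Let $G$ be the graph obtained by adding edges $e_1,\dots,e_m$ to $G_1\cup G_2$, where each $e_j$ joins a vertex of $S_1$ to a vertex of $S_2$. Then $G$ is $\theta$-super positive.
   Context: All graphs are finite and simple. $\mu(G,x)=\sum_{r\ge0}(-1)^r p(G,r)x^{n-2r}$ is the matching polynomial of a graph $G$ on $n$ vertices, where $p(G,r)$ is the number of $r$-matchings ($p(G,0)=1$); $\mathrm{mult}(\theta,G)$ is the multiplicity of $\theta$ as a root of $\mu(G,x)$. $G\setminus X$ denotes deletion of the vertex set $X$. A vertex $u$ of $H$ is $\theta$-essential if $\mathrm{mult}(\theta,H\setminus u)=\mathrm{mult}(\theta,H)-1$ and $\theta$-positive if $\mathrm{mult}(\theta,H\setminus u)=\mathrm{mult}(\theta,H)+1$. $G$ is $\theta$-super positive if $\mathrm{mult}(\theta,G)=0$ and every vertex is $\theta$-positive. A graph $H$ is $\theta$-critical if all its vertices are $\theta$-essential and $\mathrm{mult}(\theta,H)=1$; $c_\theta(H)$ is the number of $\theta$-critical components of $H$. $X\subseteq V(G)$ is a $\theta$-barrier set if $\mathrm{mult}(\theta,G)=c_\theta(G\setminus X)-|X|$; $\mathfrak P(\theta,G)$ is the set of all $\theta$-barrier sets of $G$. *)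

(* Defs.v *)
From mathcomp Require Import all_boot all_order all_algebra.
From mathcomp Require Export reals.

Set Implicit Arguments.
Unset Strict Implicit.
Unset Printing Implicit Defensive.

Import GRing.Theory.
Local Open Scope ring_scope.

Record sgraph := SGraph {
  vertex :> finType;
  adj : rel vertex;
  adj_sym : symmetric adj;
  adj_irrefl : irreflexive adj
}.

Section Subgraphs.
Variable G : sgraph.

Section Induced.
Variable A : {set G}.

Definition induced_adj : rel {x : G | x \in A} :=
  fun x y => adj (val x) (val y).

Lemma induced_adj_sym : symmetric induced_adj.
Proof. by move=> x y; apply: adj_sym. Qed.

Lemma induced_adj_irrefl : irreflexive induced_adj.
Proof. by move=> x; apply: adj_irrefl. Qed.

Definition induced : sgraph := SGraph induced_adj_sym induced_adj_irrefl.
End Induced.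

Definition delete (X : {set G}) : sgraph := induced (~: X).

Definition edges : {set {set G}} :=
  [set e : {set G} | [exists x, exists y, adj x y && (e == [set x; y])]].

(* Distinct members of [M] are disjoint. *)
Definition matching (M : {set {set G}}) : bool :=
  (M \subset edges) && trivIset M.

Definition nb_matchings (r : nat) : nat :=
  #|[set M : {set {set G}} | matching M & #|M| == r]|.

Definition components : {set {set G}} :=
  equivalence_partition (connect (@adj G)) [set: G].
End Subgraphs.

Section Theta.
Variables (R : realType) (theta : R).
Implicit Type G : sgraph.

(* An r-matching covers 2r vertices, so only the indices r <= #|G| / 2
   contribute; for these the exponent is a genuine difference. *)
Definition matching_poly G : {poly R} :=
  \sum_(r < #|G|./2.+1)
    ((-1) ^+ r * (nb_matchings G r)%:R) *: 'X^(#|G| - 2 * r).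

Definition mult G : nat := mup theta (matching_poly G).

(* Relations between multiplicities are written without natural-number
   subtraction, which would truncate at 0. *)
Definition essential G (u : G) : bool :=
  (mult (delete [set u])).+1 == mult G.

Definition positive G (u : G) : bool :=
  mult (delete [set u]) == (mult G).+1.

Definition super_positive G : bool :=
  (mult G == 0%N) && [forall u : G, positive u].

Definition critical G : bool :=
  [forall u : G, essential u] && (mult G == 1%N).

Definition nb_critical G : nat :=
  #|[set C in components G | critical (induced C)]|.

Definition barrier_sets G : {set {set G}} :=
  [set X : {set G} | (mult G + #|X|)%N == nb_critical (delete X)].
End Theta.

Section Join.
Variables (G1 G2 : sgraph) (E : {set G1 * G2}).

Definition join_adj : rel (G1 + G2)%type := fun u v =>
  match u, v with
  | inl x, inl y => adj x y
  | inr x, inr y => adj x y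
  | inl x, inr y => (x, y) \in E
  | inr y, inl x => (x, y) \in E
  end.

Lemma join_adj_sym : symmetric join_adj.
Proof. by case=> x [] y //=; apply: adj_sym. Qed.

Lemma join_adj_irrefl : irreflexive join_adj.
Proof. by case=> x /=; apply: adj_irrefl. Qed.

(* The disjoint union of [G1] and [G2] together with an edge x -- y for each
   pair (x, y) in [E]. *)
Definition join : sgraph := SGraph join_adj_sym join_adj_irrefl.
End Join.

(* Main.v *)
(* Interlacing: with p = mu(G) and q = mu(G \ u), the vertex recurrence
   p = X q - \sum_(v ~ u) mu(G \ u \ v) and induction show that p' q - p q' is
   q^2 plus a sum of squares. This forces mult(G) <= mult(G \ u) + 1, and then
   the recurrence gives mult(G \ u) <= mult(G) + 1.

   Let S be a barrier set of a graph H with mult(H) = 0. Multiplicativity over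
   components gives mult(H \ S) >= |S|, so by interlacing mult(H \ T) >= |T| for
   all T contained in S; thus theta is a root of mu(H \ T) when T is nonempty.
   Now expand mu(join) at theta over the sets of added edges used by a matching:
   only the empty set contributes, and mu(join)(theta) is the product
   mu(G1)(theta) mu(G2)(theta), nonzero. The same expansion after deleting
   u in G1 only uses the barrier of G2 and gives
   mu(G1 \ u)(theta) mu(G2)(theta) = 0, so the multiplicity is at least 1, and by
   interlacing exactly 1. *)
Require Import Defs.
From mathcomp Require Import all_boot all_order all_algebra.
From mathcomp Require Import ring zify.

Set Implicit Arguments.
Unset Strict Implicit.
Unset Printing Implicit Defensive.

Import Order.TTheory GRing.Theory Num.Theory.
Local Open Scope ring_scope.

(** * Edges as two-element sets, and matchings inside a vertex set *)

Section Matchings.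
Variable G : sgraph.
Implicit Types (A : {set G}) (M : {set {set G}}) (u v : G).

Lemma edge2 u v : ([set u; v] \in edges G) = adj u v.
Proof.
rewrite inE; apply/existsP/idP => [[x /existsP[y /andP[xy /eqP/setP e]]]|uv].
  have := e y; have := e v; have := e u; rewrite !inE !eqxx !orbT /= => /esym eu /esym ev.
  have uv : u != v.
    apply: contraTneq xy => uv; have := e x; have := e y.
    rewrite -uv !inE !eqxx !orbb orbT /= => /eqP -> /eqP ->.
    by rewrite adj_irrefl.
  case/orP: eu uv => /eqP ->; case/orP: ev => /eqP ->; rewrite ?eqxx //.
  by rewrite adj_sym.
by exists u; apply/existsP; exists v; rewrite uv eqxx.
Qed.

Lemma edgeP (e : {set G}) :
  reflect (exists u v, adj u v /\ e = [set u; v]) (e \in edges G).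
Proof.
rewrite inE; apply: (iffP existsP) => [[x /existsP[y /andP[xy /eqP ->]]]|].
  by exists x, y.
by case=> x [y [xy ->]]; exists x; apply/existsP; exists y; rewrite xy /=.
Qed.

Lemma adj_neq u v : adj u v -> u != v.
Proof. by apply: contraTneq => ->; rewrite adj_irrefl. Qed.

Lemma card_cover_matching M : matching M -> #|cover M| = (2 * #|M|)%N.
Proof.
case/andP=> /subsetP sM /eqP <-; rewrite mulnC -sum_nat_const.
apply: eq_bigr => e /sM /edgeP[x [y [xy ->]]].
by rewrite cards2 (adj_neq xy).
Qed.

Definition matchings_in A := [set M | matching M & cover M \subset A].

Lemma card_matchings_in A M : M \in matchings_in A -> (2 * #|M| <= #|A|)%N.
Proof.
by rewrite inE => /andP[/card_cover_matching <-]; apply: subset_leq_card.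
Qed.

Lemma set0_matchings_in A : set0 \in matchings_in A.
Proof.
by rewrite inE /matching sub0set /cover big_set0 sub0set /trivIset /cover !big_set0 cards0 eqxx.
Qed.

Lemma matchings_inD1 A u M :
  (M \in matchings_in (A :\ u)) = (M \in matchings_in A) && (u \notin cover M).
Proof. by rewrite !inE subsetD1 andbA. Qed.

Lemma mem_matchings_in_edge A u v M :
  [set u; v] \in M -> (M \in matchings_in A) ->
  M :\ [set u; v] \in matchings_in (A :\ u :\ v).
Proof.
rewrite !inE /matching => uvM /andP[/andP[sM tM] cM].
rewrite trivIsetD // andbT (subset_trans (subsetDl _ _) sM) /=.
rewrite coverD1 // setDDl; exact: setSD.
Qed.

(** Together with [mem_matchings_in_edge] this makes inserting and removing the edge [uv] inverse
    bijections, as [mpoly_in_rec] requires. *)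
Lemma matchings_in_add A u v M :
  adj u v -> u \in A -> v \in A -> M \in matchings_in (A :\ u :\ v) ->
  ([set u; v] \notin M) && ([set u; v] |: M \in matchings_in A).
Proof.
move=> uv uA vA; rewrite !matchings_inD1 => /andP[/andP[MA uM] vM].
have uvM : [set u; v] \notin M.
  by apply: contra uM => h; apply/bigcupP; exists [set u; v]; rewrite ?inE ?eqxx.
rewrite uvM /=; move: MA; rewrite !inE /matching => /andP[/andP[sM tM] cM].
have -> : [set u; v] |: M \subset edges G.
  by apply/subsetP => e /setU1P[->|/(subsetP sM)//]; rewrite edge2.
rewrite trivIsetU //=.
- by rewrite /cover big_setU1 //= !subUset !sub1set uA vA.
- by rewrite /trivIset /cover !big_set1.
rewrite {1}/cover big_set1 -setI_eq0; apply/eqP/setP => x; rewrite !inE.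
by case: eqP => [->|_] /=; [rewrite (negPf uM)|case: eqP => [->|//]; rewrite (negPf vM)].
Qed.

(** Disjointness of the edges gives a covered vertex exactly one partner. This sorts the matchings
    that cover [u] by the partner of [u]. *)
Lemma sum_covered_edge M u : matching M ->
  (\sum_(v : G) ([set u; v] \in M) = (u \in cover M))%N.
Proof.
move=> /andP[/subsetP sM tM]; case: (boolP (u \in cover M)) => /= [/bigcupP[e eM ue]|uM].
  have [v def_e] : exists v, e = [set u; v].
    have /edgeP[x [y [xy de]]] := sM _ eM; move: ue; rewrite de !inE.
    by case/orP=> /eqP ->; [exists y | exists x; rewrite setUC].
  rewrite (bigD1 v) //= -def_e eM big1 // => w wv; apply/eqP; rewrite eqb0.
  apply: contra wv => uwM.
  have e2 : [set u; w] = e.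
    by rewrite -(def_pblock tM eM ue) (def_pblock tM uwM) // !inE eqxx.
  have uw := adj_neq (etrans (esym (edge2 u w)) (sM _ uwM)).
  have : w \in e by rewrite -e2 !inE eqxx orbT.
  by rewrite def_e !inE eq_sym (negPf uw).
rewrite big1 // => v _; apply/eqP; rewrite eqb0; apply: contra uM => h.
by apply/bigcupP; exists [set u; v]; rewrite ?inE ?eqxx.
Qed.

End Matchings.

(** * Matching polynomials relative to a vertex set *)

Section MatchingPoly.
Variable R : realType.

(** The matching polynomial of the subgraph induced on [A], kept inside [G] so that repeated vertex
    deletions are set differences and need no change of type. *)
Definition mpoly_in (G : sgraph) (A : {set G}) : {poly R} :=
  \sum_(M in matchings_in A) (-1) ^+ #|M| *: 'X^(#|A| - 2 * #|M|).

Section Recurrence.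
Variable G : sgraph.
Implicit Types (A : {set G}) (u v : G).
Local Notation mu := (@mpoly_in G).

(** Matchings missing [u] give the first term. The others contain a unique edge [uv], and removing
    it flips the sign. *)
Lemma mpoly_in_rec A u : u \in A ->
  mu A = 'X * mu (A :\ u) - \sum_(v in A | adj u v) mu (A :\ u :\ v).
Proof.
move=> uA; rewrite {1}/mpoly_in (bigID (fun M => u \notin cover M)) /=.
congr (_ + _).
  rewrite /mpoly_in mulr_sumr; apply: eq_big => [M|M]; rewrite -matchings_inD1 // => MA.
  rewrite -scalerAr -exprS; congr (_ *: 'X^ _).
  have := card_matchings_in MA; rewrite (cardsD1 u A) uA => hM; rewrite -subSn //.
(* The inner sum has one term if [M] covers [u] and none otherwise, so the side condition on [M] is
   absorbed. *)
transitivity (\sum_(M in matchings_in A) \sum_(v : G | [set u; v] \in M)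
    (-1) ^+ #|M| *: 'X^(#|A| - 2 * #|M|) : {poly R}).
  rewrite big_mkcondr /=; apply: eq_bigr => M; rewrite inE sumr_const => /andP[mM _].
  have <- : (u \in cover M : nat) = #|[pred v | [set u; v] \in M]|.
    rewrite -sum_covered_edge // -sum1_card [RHS]big_mkcond /=.
    by apply: eq_bigr => v _; rewrite inE; case: ifP.
  by rewrite negbK; case: ifP.
rewrite (exchange_big_dep xpredT) //= -sumrN [RHS]big_mkcond /=.
apply: eq_bigr => v _; case: ifP => [/andP[vA uv]|no]; last first.
  rewrite big1 // => M /andP[MA uvM]; case/negP: no; move: MA.
  rewrite inE /matching => /andP[/andP[/subsetP sM _] /subsetP cM].
  rewrite -(edge2 u v) (sM _ uvM) andbT; apply: cM.
  by apply/bigcupP; exists [set u; v]; rewrite // !inE eqxx orbT.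
rewrite (reindex_onto (fun M => [set u; v] |: M) (fun M => M :\ [set u; v])) /=.
  rewrite /mpoly_in -sumrN; apply: eq_big => [M|M /andP[/andP[MA _] /eqP MK]].
    apply/idP/idP => [/andP[/andP[MA uvM] /eqP <-]|/(matchings_in_add uv uA vA)].
      exact: mem_matchings_in_edge.
    by case/andP=> uvM ->; rewrite setU11 setU1K ?eqxx.
  have uvM : [set u; v] \notin M by rewrite -MK !inE eqxx.
  have /card_matchings_in := mem_matchings_in_edge (setU11 _ _) MA.
  rewrite MK cardsU1 uvM exprS mulN1r scaleNr => _; congr (- (_ *: 'X^ _)).
  rewrite (cardsD1 u A) uA (cardsD1 v (A :\ u)) !inE vA eq_sym (adj_neq uv).
  rewrite mulnDr addnA; exact: subnDl.
by move=> M /andP[_ uvM]; rewrite setD1K.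
Qed.

Lemma mpoly_in_set0 : mu set0 = 1.
Proof.
rewrite /mpoly_in (bigD1 set0) ?set0_matchings_in //= !cards0 expr0 scale1r.
rewrite big1 ?addr0 // => M /andP[/card_matchings_in].
by rewrite cards0 leqn0 muln_eq0 /= cards_eq0 => ->.
Qed.

(** Only the empty matching contributes in degree [#|A|]. Nonvanishing lets [mup_geq] translate
    multiplicities into divisibility. *)
Lemma mpoly_in_neq0 A : mu A != 0.
Proof.
suff: (mu A)`_#|A| != 0 by apply: contraNneq => ->; rewrite coef0.
rewrite coef_sum (bigD1 set0) ?set0_matchings_in //= big1 ?addr0 => [|M /andP[MA M0]].
  by rewrite cards0 coefZ coefXn muln0 subn0 eqxx mulr1 oner_eq0.
have := card_matchings_in MA; rewrite -cards_eq0 -lt0n in M0.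
rewrite coefZ coefXn => leA; rewrite -[X in X == _](subnK leA) -[X in _ == X]addn0.
by rewrite eqn_add2l muln_eq0 /= eqn0Ngt M0 mulr0.
Qed.

Lemma mpoly_inT : mu [set: G] = matching_poly R G.
Proof.
(* [inord] loses nothing here: a matching has at most [#|G|./2] edges. *)
pose p (M : {set {set G}}) : 'I_(#|G|./2.+1) := inord #|M|.
rewrite /mpoly_in (partition_big p xpredT) //=; apply: eq_bigr => r _.
have leM (M : {set {set G}}) : M \in matchings_in [set: G] -> p M = #|M| :> nat.
  by move/card_matchings_in; rewrite cardsT => h; rewrite inordK // ltnS; lia.
rewrite (eq_bigr (fun=> (-1) ^+ r *: 'X^(#|G| - 2 * r))); last first.
  by move=> M /andP[MA /eqP <-]; rewrite leM // cardsT.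
rewrite sumr_const mulr_natr -scalerMnl; congr (_ *+ _).
apply: eq_card => M; rewrite unfold_in /= [RHS]inE.
have MT : (M \in matchings_in [set: G]) = matching M by rewrite inE subsetT andbT.
rewrite MT; case mM : (matching M) => //=.
by rewrite -val_eqE /= leM // MT.
Qed.

End Recurrence.

(** Invariance under induced embeddings, used for the inclusion of an induced subgraph and for the
    two inclusions into the join. *)
Lemma mpoly_in_imset (H G : sgraph) (f : H -> G) (A : {set H}) :
  injective f -> (forall x y, adj (f x) (f y) = adj x y) ->
  mpoly_in (f @: A) = mpoly_in A.
Proof.
move=> f_inj f_adj; pose F (M : {set {set H}}) : {set {set G}} := [set f @: e | e : {set H} in M].
have f2_inj : injective (fun e : {set H} => f @: e) by apply: imset_inj.
have F_inj : injective F by apply: imset_inj.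
have f2 x y : f @: [set x; y] = [set f x; f y] by rewrite imsetU !imset_set1.
have edgesF (e : {set H}) : (f @: e \in edges G) = (e \in edges H).
  apply/edgeP/edgeP => [[u [v [uv de]]]|[x [y [xy ->]]]]; last first.
    by exists (f x), (f y); rewrite f_adj f2.
  have /imsetP[x _ ux] : u \in f @: e by rewrite de !inE eqxx.
  have /imsetP[y _ vy] : v \in f @: e by rewrite de !inE eqxx orbT.
  exists x, y; split; first by rewrite -f_adj -ux -vy.
  by apply: f2_inj; rewrite /= de f2 ux vy.
have coverF M : cover (F M) = f @: cover M.
  by rewrite cover_imset imset_cover.
have FP M : (F M \in matchings_in (f @: A)) = (M \in matchings_in A).
  rewrite !inE /matching coverF imset_trivIset //.
  congr (_ && _ && _); last first.
    apply/idP/idP => [/subsetP sA|]; last exact: imsetS.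
    by apply/subsetP => x xM; rewrite -(mem_imset _ _ f_inj) sA ?mem_imset.
  apply/subsetP/subsetP => sM e; last by case/imsetP=> e' /sM; rewrite -edgesF => ? ->.
  by move=> eM; rewrite -edgesF; apply: sM; apply: imset_f.
(* A matching covering only vertices of the image is recovered from the preimages of its edges. *)
have matF (N : {set {set G}}) : (N \in matchings_in (f @: A)) = (N \in F @: matchings_in A).
  apply/idP/imsetP => [NA|[M MA ->]]; last by rewrite FP.
  suff defN : N = F [set e : {set H} | f @: e \in N].
    by exists [set e : {set H} | f @: e \in N] => //; rewrite -FP -defN.
  apply/setP => e; apply/idP/imsetP => [eN|[e' + ->]]; last by rewrite inE.
  have defe : e = f @: (f @^-1: e).
    apply/setP => y; apply/idP/imsetP => [ye|[x + ->]]; last by rewrite inE.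
    move: NA; rewrite inE => /andP[_ /subsetP cN].
    have /cN /imsetP[x _ yx] : y \in cover N by apply/bigcupP; exists e.
    by exists x; rewrite // inE -yx.
  by exists (f @^-1: e); rewrite ?inE -?defe.
rewrite {1}/mpoly_in (eq_bigl _ _ matF) big_imset; last by move=> x y _ _; apply: F_inj.
by apply: eq_bigr => M _; rewrite !card_imset.
Qed.

Lemma matching_poly_induced (G : sgraph) (A : {set G}) :
  matching_poly R (induced A) = mpoly_in A.
Proof.
have e : A = val @: [set: induced A].
  apply/setP => x; apply/idP/imsetP => [xA|[y _ ->]]; last exact: (valP y).
  by exists (Sub x xA); rewrite ?inE.
rewrite [in RHS]e -mpoly_inT; symmetry.
by apply: (@mpoly_in_imset (induced A) G val) => //; apply: val_inj.
Qed.

End MatchingPoly.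

(** * Sums of squares of polynomials and order of vanishing *)

Section SumsOfSquares.
Variable R : realFieldType.
Implicit Types (p q t : {poly R}) (s : seq {poly R}).

Definition sum_sqr p := exists s, p = \sum_(t <- s) t ^+ 2.

Lemma sum_sqr_sum (I : finType) (P : pred I) (F : I -> {poly R}) :
  (forall i, P i -> sum_sqr (F i)) -> sum_sqr (\sum_(i | P i) F i).
Proof.
move=> sF; apply: (big_ind sum_sqr) => //; first by exists [::]; rewrite big_nil.
by move=> _ _ [s ->] [s' ->]; exists (s ++ s'); rewrite big_cat.
Qed.

(** A sum of real squares vanishes at [a] only if each term does. Every [t] is then divisible by
    ['X - a%:P], and cancelling its square lowers [k] by one. *)
Lemma dvdp_sum_sqr (a : R) k s :
  ('X - a%:P) ^+ (2 * k).+1 %| \sum_(t <- s) t ^+ 2 ->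
  {in s, forall t, ('X - a%:P) ^+ k.+1 %| t}.
Proof.
elim: k s => [|k IHk] s dvd_s.
  move=> t ts; rewrite expr1 dvdp_XsubCl; move: dvd_s.
  rewrite expr1 dvdp_XsubCl rootE horner_sum psumr_eq0 => [/allP/(_ t ts)|i _].
    by rewrite horner_exp sqrf_eq0.
  by rewrite horner_exp sqr_ge0.
have roots t : t \in s -> t = ('X - a%:P) * (t %/ ('X - a%:P)).
  move=> ts; rewrite mulrC divpK //.
  move: dvd_s; rewrite mulnS !addSn add0n exprS => /(dvdp_trans (dvdp_mulr _ (dvdpp _))).
  rewrite !dvdp_XsubCl rootE horner_sum psumr_eq0 => [/allP/(_ t ts)|i _].
    by rewrite horner_exp sqrf_eq0.
  by rewrite horner_exp sqr_ge0.
move=> t ts; rewrite (roots t ts) exprS dvdp_mul2l ?polyXsubC_eq0 //.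
apply: (IHk [seq t %/ ('X - a%:P) | t <- s]); last exact: map_f.
have X2 : ('X - a%:P) ^+ 2 != 0 by rewrite expf_neq0 ?polyXsubC_eq0.
rewrite big_map -(dvdp_mul2l _ _ X2) -exprD mulr_sumr.
have -> : (2 + (2 * k).+1 = (2 * k.+1).+1)%N by lia.
apply: etrans dvd_s; congr (_ %| _); apply: eq_big_seq => i si.
by rewrite [in RHS](roots i si) exprMn.
Qed.

(* With [k] the multiplicity of [q], if [p] had multiplicity at least [k + 2]
   then the left-hand side would vanish to order [2 k + 1], hence so would
   every square on the right, and [q] would vanish to order [k + 1]. *)
Lemma mup_le_wronskian (a : R) p q w : p != 0 -> q != 0 -> sum_sqr w ->
  p^`() * q - p * q^`() = q ^+ 2 + w -> (mup a p <= (mup a q).+1)%N.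
Proof.
move=> p0 q0 [s ->] Wpq; rewrite leqNgt; apply/negP; set k := mup a q.
rewrite mup_geq // -addn2 exprD => /dvdpP[P def_p].
have /dvdpP[Q def_q] : ('X - a%:P) ^+ k %| q by rewrite -mup_geq.
have /(_ q) : {in q :: s, forall t, ('X - a%:P) ^+ k.+1 %| t}.
  apply: dvdp_sum_sqr; rewrite big_cons -Wpq def_p def_q.
  (* The Wronskian divided by [('X - a%:P) ^+ (2 * k).+1]. The terms with the derivative of
     [('X - a%:P) ^+ k] cancel, so that derivative may be generalized to any [D']. *)
  apply/dvdpP; exists (P^`() * ('X - a%:P) * Q + P * Q *+ 2 - P * ('X - a%:P) * Q^`()).
  rewrite (exprS _ (2 * k)) mulnC exprM !expr2 !derivM derivXsubC.
  move: (('X - a%:P) ^+ k) (_^`()) => D D'; ring.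
by rewrite inE eqxx -mup_geq // ltnn => /(_ isT).
Qed.

End SumsOfSquares.

(** * Multiplicities under vertex deletion *)

Section Interlacing.
Variables (R : realType) (G : sgraph).
Implicit Types (A T : {set G}) (u v : G).
Local Notation mu := (@mpoly_in R G).

Lemma mpoly_in_wronskian A u : u \in A -> exists2 w, sum_sqr w &
  (mu A)^`() * mu (A :\ u) - mu A * (mu (A :\ u))^`() = mu (A :\ u) ^+ 2 + w.
Proof.
have [n] := ubnP #|A|; elim: n A u => // n IHn A u.
rewrite ltnS (cardsD1 u) => + uA; rewrite uA => ltAn.
set q := mu (A :\ u).
pose r v := mu (A :\ u :\ v).
(* Substituting the recurrence for [mu A] leaves [q ^+ 2] plus the Wronskians of the pairs [q],
   [r v]. Induction on [A :\ u] writes each as [r v ^+ 2] plus squares. *)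
exists (\sum_(v in A | adj u v) (q^`() * r v - q * (r v)^`())).
  apply: sum_sqr_sum => v /andP[vA uv].
  have [|w [s ws] ->] := IHn (A :\ u) v ltAn.
    by rewrite !inE vA eq_sym adj_neq.
  by exists (r v :: s); rewrite big_cons -ws.
rewrite (mpoly_in_rec _ uA) -/q big_split /= sumrN -!mulr_sumr.
set S := \sum_(v in A | _) r v.
have <- : S^`() = \sum_(v in A | adj u v) (r v)^`() by rewrite /S raddf_sum.
rewrite -/S derivB derivM derivX; ring.
Qed.

Variable a : R.

Lemma mup_mpoly_inD1 A u : u \in A -> (mup a (mu A) <= (mup a (mu (A :\ u))).+1)%N.
Proof.
case/mpoly_in_wronskian=> w sw /mup_le_wronskian -> //; exact: mpoly_in_neq0.
Qed.

Lemma mup_mpoly_in_leD1 A u : u \in A -> (mup a (mu (A :\ u)) <= (mup a (mu A)).+1)%N.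
Proof.
move=> uA; set k := mup a (mu (A :\ u)).
(* Each [A :\ u :\ v] has multiplicity at least [k.-1] by [mup_mpoly_inD1], so this power divides
   every term of the recurrence. For [k = 0] it is 1. *)
suff : ('X - a%:P) ^+ k.-1 %| mu A.
  by rewrite -mup_geq ?mpoly_in_neq0 // -subn1 leq_subLR.
rewrite (mpoly_in_rec _ uA) dvdp_sub //.
  by rewrite dvdp_mull // -mup_geq ?mpoly_in_neq0 // leq_pred.
apply: (big_ind (fun p => ('X - a%:P) ^+ k.-1 %| p)) => [|p q|v /andP[vA uv]]; [exact: dvdp0|exact: dvdp_add|].
rewrite -mup_geq ?mpoly_in_neq0 // -subn1 leq_subLR add1n.
by apply: mup_mpoly_inD1; rewrite !inE vA eq_sym adj_neq.
Qed.

Lemma mup_mpoly_in_leD A T : T \subset A ->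
  (mup a (mu (A :\: T)) <= mup a (mu A) + #|T|)%N.
Proof.
have [n] := ubnP #|T|; elim: n T => // n IHn T.
have [->|/set0Pn[u uT]] := eqVneq T set0; first by rewrite setD0 leq_addr.
rewrite (cardsD1 u) uT ltnS => ltTn sTA.
have sTA' := subset_trans (subsetDl T [set u]) sTA.
rewrite -[in A :\: T](setD1K uT) setUC -setDDl.
have uA : u \in A :\: (T :\ u) by rewrite !inE eqxx (subsetP sTA).
apply: leq_trans (mup_mpoly_in_leD1 uA) _.
by rewrite addnA addn1 addSn ltnS IHn.
Qed.

End Interlacing.

(** * Factorization over unions and connected components *)

Section Factorization.
Variables (R : realType) (G : sgraph).
Implicit Types (A B S T : {set G}) (u v : G).
Local Notation mu := (@mpoly_in R G).

(* Every matching using an edge between [A] and [B] contributes a multiple of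
   some [phi (mu (B :\: T))] with [T] nonempty. With [phi] the identity and
   [S] empty this is multiplicativity over disjoint unions. *)
Lemma rmorph_mpoly_inU (K : comNzRingType) (phi : {rmorphism {poly R} -> K})
    A B S :
  [disjoint A & B] -> {in A & B, forall x y, adj x y -> y \in S} ->
  (forall T, T \subset S :&: B -> T != set0 -> phi (mu (B :\: T)) = 0) ->
  phi (mu (A :|: B)) = phi (mu A) * phi (mu B).
Proof.
have [n] := ubnP #|A|; elim: n A B => // n IHn A B.
have [->|/set0Pn[u uA]] := eqVneq A set0.
  by rewrite set0U mpoly_in_set0 rmorph1 mul1r.
rewrite (cardsD1 u) uA ltnS => ltAn dAB adjS phi0.
have disjW A' B' : A' \subset A -> B' \subset B -> [disjoint A' & B'].
  by move=> sA sB; apply: disjointWl sA _; apply: disjointWr sB _.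
have adjW A' B' : A' \subset A -> B' \subset B ->
    {in A' & B', forall x y, adj x y -> y \in S}.
  by move=> /subsetP sA /subsetP sB x y /sA xA /sB yB; apply: adjS.
have phi_sum (P : pred G) F : phi (\sum_(v | P v) F v) = \sum_(v | P v) phi (F v).
  exact: rmorph_sum.
have sA1 : A :\ u \subset A by apply: subsetDl.
have uB : u \notin B by rewrite (disjointFr dAB).
have U1 : (A :|: B) :\ u = (A :\ u) :|: B.
  by rewrite setDUl; congr (_ :|: _); apply/setDidPl; rewrite disjoint_sym disjoints1.
rewrite (mpoly_in_rec _ (_ : u \in A :|: B)) ?inE ?uA //.
rewrite (mpoly_in_rec _ uA) U1 !rmorphB !rmorphM !phi_sum mulrBl -mulrA.
rewrite IHn //; [|exact: disjW|exact: adjW].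
congr (_ - _); rewrite mulr_suml big_mkcondr (eq_bigl [in [predU A & B]]) => [|v]; last by rewrite !inE.
rewrite bigU // -!big_mkcondr /=.
rewrite [X in _ + X]big1 ?addr0 => [|v /andP[vB uv]].
  apply: eq_bigr => v /andP[vA uv].
  have sA2 : A :\ u :\ v \subset A by apply: subset_trans (subsetDl _ _) sA1.
  have -> : ((A :\ u) :|: B) :\ v = (A :\ u :\ v) :|: B.
    rewrite setDUl; congr (_ :|: _); apply/setDidPl.
    by rewrite disjoint_sym disjoints1 (disjointFr dAB).
  rewrite IHn //; [|exact: disjW|exact: adjW].
  exact: leq_ltn_trans (subset_leq_card (subsetDl _ _)) ltAn.
(* An edge from [u] into [B] ends in [S]. By induction its term factors through [phi (mu (B :\ v))],
   which is zero. *)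
have vS : v \in S by apply: (adjS u v).
have -> : ((A :\ u) :|: B) :\ v = (A :\ u) :|: (B :\ v).
  rewrite setDUl; congr (_ :|: _); apply/setDidPl.
  by rewrite disjoint_sym disjoints1 !inE (disjointFl dAB) ?andbF.
have sB1 : B :\ v \subset B by apply: subsetDl.
rewrite IHn //; [|by apply: disjW|by apply: adjW|].
  rewrite phi0 ?mulr0 ?sub1set ?inE ?vS //.
  by apply/set0Pn; exists v; rewrite inE.
(* The vanishing hypothesis passes to [B :\ v], since deleting [T] from it deletes [v |: T] from
   [B]. *)
move=> T; rewrite subsetI subsetD1 => /and3P[TS TB _] _; rewrite setDDl phi0 //.
  by rewrite subUset sub1set inE vS vB subsetI TS TB.
by apply/set0Pn; exists v; rewrite !inE eqxx.
Qed.

Lemma connect_adj_equivalence :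
  {in [set: G] & &, equivalence_rel (connect (@adj G))}.
Proof.
move=> x y z _ _ _; split=> [|xy]; first exact: connect0.
exact: same_connect (sym_connect_sym (@adj_sym G)) _ _ xy _.
Qed.

Lemma mem_components (C : {set G}) x y :
  C \in components G -> x \in C -> (y \in C) = connect (@adj G) x y.
Proof.
have eqr := connect_adj_equivalence.
move=> CP xC; have [/eqP covP triv _] := and3P (equivalence_partitionP eqr).
by rewrite -(pblock_equivalence_partition eqr) ?inE // (def_pblock triv CP xC).
Qed.

(** Components are split off one at a time. Stating this for any subfamily [P] makes the induction
    possible. *)
Lemma mpoly_in_cover (P : {set {set G}}) :
  P \subset components G -> mu (cover P) = \prod_(C in P) mu C.
Proof.
have [n] := ubnP #|P|; elim: n P => // n IHn P.
have [->|/set0Pn[C CP]] := eqVneq P set0.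
  by rewrite /cover !big_set0 mpoly_in_set0.
rewrite (cardsD1 C) CP ltnS => ltPn sP.
have sP' := subset_trans (subsetDl P [set C]) sP.
have no_edge x y : x \in C -> y \in cover (P :\ C) -> ~~ connect (@adj G) x y.
  move=> xC /bigcupP[D /setD1P[DC DP] yD]; apply: contra DC => xy; apply/eqP/setP => z.
  have yC : y \in C by rewrite (mem_components _ (subsetP sP _ CP) xC).
  rewrite (mem_components _ (subsetP sP _ CP) yC).
  by rewrite (mem_components _ (subsetP sP _ DP) yD).
rewrite (big_setD1 C CP) /= -IHn // -[in LHS](setD1K CP) /cover.
rewrite big_setU1 ?setD11 //= -/(cover _).
(* With [S] empty, the adjacency hypothesis says that no edge leaves [C], and the vanishing
   hypothesis is vacuous. *)
apply: (@rmorph_mpoly_inU _ idfun _ _ set0).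
- rewrite disjoint_subset; apply/subsetP => x xC; rewrite inE.
  by apply/negP => /(no_edge x x xC); rewrite connect0.
- by move=> x y xC /(no_edge x y xC) + xy; rewrite connect1.
by move=> T; rewrite set0I subset0 => ->.
Qed.

End Factorization.

(** * Barrier sets and roots after deletion *)

Section Barriers.
Variables (R : realType) (theta : R).
Implicit Types G H J : sgraph.

Lemma mup_prod (I : finType) (P : pred I) (F : I -> {poly R}) :
  (forall i, P i -> F i != 0) ->
  mup theta (\prod_(i | P i) F i) = (\sum_(i | P i) mup theta (F i))%N.
Proof.
move=> F0; suff [] : \prod_(i | P i) F i != 0 /\
  mup theta (\prod_(i | P i) F i) = (\sum_(i | P i) mup theta (F i))%N by [].
apply: (big_rec2 (fun p k => p != 0 /\ mup theta p = k)).
  by rewrite oner_neq0 mupNroot // root1.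
by move=> i p k Pi [p0 <-]; rewrite mulf_neq0 ?F0 // mupM ?F0.
Qed.

Lemma mult_mpoly_in G : mult theta G = mup theta (mpoly_in R [set: G]).
Proof. by rewrite mpoly_inT. Qed.

Lemma mult_induced G (A : {set G}) :
  mult theta (induced A) = mup theta (mpoly_in R A).
Proof. by rewrite /mult matching_poly_induced. Qed.

(** Multiplicities add up over components, and each critical component contributes exactly 1. *)
Lemma nb_critical_le_mult G : (nb_critical theta G <= mult theta G)%N.
Proof.
have covT : cover (components G) = [set: G].
  exact: cover_partition (equivalence_partitionP (@connect_adj_equivalence G)).
rewrite mult_mpoly_in -covT mpoly_in_cover // mup_prod => [|C _]; last exact: mpoly_in_neq0.
rewrite /nb_critical -sum1_card.
rewrite [leqRHS](big_setID [set C | critical theta (induced C)]) /= -setIdE.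
apply: leq_trans (leq_addr _ _); apply: leq_sum => C.
by rewrite inE => /andP[_ /andP[_ /eqP]]; rewrite mult_induced => ->.
Qed.

Lemma root_mpoly_inC_barrier G (S T : {set G}) :
  mult theta G = 0%N -> S \in barrier_sets theta G -> T \subset S -> T != set0 ->
  root (mpoly_in R (~: T)) theta.
Proof.
move=> m0; rewrite inE m0 add0n => /eqP cardS sTS T0.
apply: contraT => /(@mupNroot _ _ _) mT.
have := nb_critical_le_mult (delete S); rewrite -cardS mult_induced.
have sD : S :\: T \subset ~: T by rewrite setDE subsetIr.
(* If [theta] were not a root for [~: T], deleting the rest of [S] would give multiplicity at most
   [#|S :\: T|], below the required [#|S|]. *)
have := mup_mpoly_in_leD theta sD.
have -> : ~: T :\: (S :\: T) = ~: S.
  by rewrite setDDr [~: T :\: S]setDE -setCU (setUidPr sTS) [_ :&: T]setIC setICr setU0.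
rewrite mT add0n => le1 /leq_trans /(_ le1).
have := cardsID T S; rewrite (setIidPr sTS) => <-.
by rewrite -[leqRHS]add0n leq_add2r leqn0 cards_eq0 (negPf T0).
Qed.

(** Abstract embeddings let the two sides of the join exchange roles. A general [A] covers both the
    whole join and a deletion on one side. *)
Lemma horner_mpoly_in_barrier J H1 H2 (f : H1 -> J) (g : H2 -> J)
    (A : {set H1}) (S : {set H2}) :
  injective f -> (forall x y, adj (f x) (f y) = adj x y) ->
  injective g -> (forall x y, adj (g x) (g y) = adj x y) ->
  (forall x y, f x != g y) -> (forall x y, adj (f x) (g y) -> y \in S) ->
  mult theta H2 = 0%N -> S \in barrier_sets theta H2 ->
  (mpoly_in R (f @: A :|: g @: [set: H2])).[theta] =
  (mpoly_in R A).[theta] * (mpoly_in R [set: H2]).[theta].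
Proof.
move=> f_inj f_adj g_inj g_adj fg adjS m0 barS.
rewrite -(mpoly_in_imset _ _ f_inj f_adj) -(mpoly_in_imset _ _ g_inj g_adj).
(* Evaluation at [theta] kills exactly the polynomials with root [theta], so the barrier supplies
   the vanishing hypothesis. *)
apply: (rmorph_mpoly_inU (phi := horner_eval theta) (S := g @: S)).
- rewrite disjoint_subset; apply/subsetP => _ /imsetP[x _ ->]; rewrite inE.
  by apply/imsetP => -[y _ /eqP]; rewrite (negPf (fg x y)).
- by move=> _ _ /imsetP[x _ ->] /imsetP[y _ ->] /adjS yS; apply: imset_f.
move=> T; rewrite subsetI => /andP[/subsetP TS _] /set0Pn[z zT].
have defT : T = g @: (g @^-1: T).
  apply/setP => y; apply/idP/imsetP => [yT|[x + ->]]; last by rewrite inE.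
  by have /imsetP[x _ yx] := TS _ yT; exists x; rewrite // inE -yx.
have -> : g @: [set: H2] :\: T = g @: (~: (g @^-1: T)).
  apply/setP => y; rewrite inE; apply/andP/imsetP => [[yT /imsetP[x _ yx]]|[x + ->]].
    by exists x; rewrite // !inE -yx.
  by rewrite !inE => ->; rewrite imset_f.
rewrite mpoly_in_imset //; apply/eqP; rewrite -/(root _ _).
apply: root_mpoly_inC_barrier m0 barS _ _.
  by apply/subsetP => x; rewrite inE => /TS; rewrite mem_imset.
by apply: contraTneq zT => T0; rewrite defT T0 imset0 inE.
Qed.

End Barriers.

(** * Super positivity of the join *)

Theorem theorem5p10 (R : realType) (theta : R) (G1 G2 : sgraph)
    (S1 : {set G1}) (S2 : {set G2}) (E : {set G1 * G2}) :
  super_positive theta G1 -> super_positive theta G2 ->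
  S1 \in barrier_sets theta G1 -> S2 \in barrier_sets theta G2 ->
  (forall e : G1 * G2, e \in E -> (e.1 \in S1) && (e.2 \in S2)) ->
  super_positive theta (join E).
Proof.
have root_delete (G : sgraph) (x : G) : super_positive theta G ->
    (mpoly_in R (~: [set x])).[theta] = 0.
  move=> /andP[/eqP m0 /forallP /(_ x)]; rewrite /positive m0 mult_induced => /eqP m1.
  by apply/rootP; apply: contraT => /(@mupNroot _ _ _); rewrite m1.
have not_root (G : sgraph) : (mult theta G == 0%N) = ~~ root (mpoly_in R [set: G]) theta.
  rewrite mult_mpoly_in -dvdp_XsubCl -[_ - _]expr1 -mup_geq ?mpoly_in_neq0 //.
  by rewrite lt0n negbK.
move=> sp1 sp2 bar1 bar2 EP.
have [m1 _] := andP sp1; have [m2 _] := andP sp2.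
pose f (x : G1) : join E := inl x; pose g (y : G2) : join E := inr y.
have f_inj : injective f by move=> x y [].
have g_inj : injective g by move=> x y [].
have fA (A : {set G1}) : (mpoly_in R (f @: A :|: g @: [set: G2])).[theta] =
            (mpoly_in R A).[theta] * (mpoly_in R [set: G2]).[theta].
  apply: (@horner_mpoly_in_barrier _ _ _ _ _ _ _ _ S2) => //; last exact/eqP.
  by move=> x y /= /EP /andP[].
(* Mirror image of [fA]: deletions in [G2] rely on the barrier [S1]. *)
have gB (B : {set G2}) : (mpoly_in R (g @: B :|: f @: [set: G1])).[theta] =
            (mpoly_in R B).[theta] * (mpoly_in R [set: G1]).[theta].
  apply: (@horner_mpoly_in_barrier _ _ _ _ _ _ _ _ S1) => //; last exact/eqP.
  by move=> x y /= /EP /andP[].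
have mJ : mult theta (join E) = 0%N.
  apply/eqP; rewrite not_root rootE.
  have -> : [set: join E] = f @: [set: G1] :|: g @: [set: G2].
    by apply/setP => -[x|y]; rewrite !inE imset_f ?orbT.
  by rewrite fA mulf_neq0 // -rootE -not_root.
apply/andP; split; first exact/eqP.
apply/forallP => u; rewrite /positive mJ eqn_leq mult_induced -setTD.
apply/andP; split.
  by have := mup_mpoly_in_leD1 theta (in_setT u); rewrite -mult_mpoly_in mJ.
(* Multiplicity at least 1 only asks for a zero at [theta]; the factor of the side containing [u]
   provides it. *)
rewrite mup_geq ?mpoly_in_neq0 // expr1 dvdp_XsubCl setTD; apply/rootP.
case: u => [x|y].
  have -> : ~: [set f x] = f @: (~: [set x]) :|: g @: [set: G2].
    apply/setP => -[z|z]; rewrite !inE.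
      by rewrite (mem_imset _ _ f_inj) !inE; case: imsetP => [[]|]; rewrite ?orbF.
    by rewrite imset_f ?orbT.
  by rewrite fA root_delete // mul0r.
have -> : ~: [set g y] = g @: (~: [set y]) :|: f @: [set: G1].
  apply/setP => -[z|z]; rewrite !inE.
    by rewrite imset_f ?orbT.
  by rewrite (mem_imset _ _ g_inj) !inE; case: imsetP => [[]|]; rewrite ?orbF.
by rewrite gB root_delete // mul0r.
Qed.
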